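(* For every even integer $n\geq 6$, $\Pi^{bichrom}(n)\leq \left\lceil \frac{n}{5}\right\rceil+1$. That is, there exist a simple polygon $P$ and a set $S$ in general position in $P$ of $n/2$ red and $n/2$ blue points such that for every red point $r\in S$ and blue point $b\in S$ there is a geodesic disk through $r$ and $b$ containing at most $\left\lceil \frac{n}{5}\right\rceil+1$ points of $S$.
   Context: $P$ is a simple polygon (a closed region). For $a,b\in P$, $g(a,b)$ denotes the shortest (geodesic) path from $a$ to $b$ inside $P$ and $|g(a,b)|$ its length. A geodesic disk with center $c$ and radius $r$ is $D(c,r)=\{x\in P:|g(c,x)|\le r\}$; it is ''through'' some points if those points lie on its boundary (distance exactly $r$ from $c$), and contains a point if the point belongs to it. General position of $S$: no three points of $S$ are geodesically collinear (one on the geodesic path between the other two), no four points among $S$ and the vertices of $P$ lie on the boundary of a common geodesic disk, there are no $x,y\in S$ and reflex vertex $p$ of $P$ with $y\in g(x,p)$, and no geodesic bisector of two points of $S$ passes through a vertex of $P$. $\Pi^{bichrom}(n)$ is the largest integer such that for every simple polygon $P$ and every such set $S$ of $n/2$ red and $n/2$ blue points, there exist a red point $r$ and a blue point $b$ such that every geodesic disk through them contains at least $\Pi^{bichrom}(n)$ points of $S$. *)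

(* Defs.v *)
From Stdlib Require Import Reals Lra Lia Arith List.
From Coquelicot Require Import Coquelicot.
Import ListNotations.
Open Scope R_scope.

Definition point : Type := (R * R)%type.

Definition edist (a b : point) : R :=
  sqrt ((fst a - fst b) ^ 2 + (snd a - snd b) ^ 2).

Definition cross (o a b : point) : R :=
  (fst a - fst o) * (snd b - snd o) - (snd a - snd o) * (fst b - fst o).

Definition on_seg (a b p : point) : Prop :=
  exists t, 0 <= t <= 1 /\
    p = (fst a + t * (fst b - fst a), snd a + t * (snd b - snd a)).

Definition vtx (V : list point) (i : nat) : point :=
  nth (i mod length V) V (0, 0).

Definition on_edge (V : list point) (i : nat) (p : point) : Prop :=
  on_seg (vtx V i) (vtx V (S i)) p.

Definition signed_area2 (V : list point) : R :=
  fold_right Rplus 0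
    (map (fun i => cross (0, 0) (vtx V i) (vtx V (S i))) (seq 0 (length V))).

(* A simple polygon: at least 3 distinct vertices, adjacent edges meet only in
   their common vertex, non-adjacent edges are disjoint.  We additionally fix
   the (harmless) convention that vertices are listed counterclockwise. *)
Definition simple_polygon (V : list point) : Prop :=
  (3 <= length V)%nat /\ NoDup V /\
  (forall i j : nat, (i < length V)%nat -> (j < length V)%nat -> i <> j ->
     forall p, on_edge V i p -> on_edge V j p ->
       (j = (S i) mod length V /\ p = vtx V j) \/
       (i = (S j) mod length V /\ p = vtx V i)) /\
  signed_area2 V > 0.

(* reflex vertex (interior angle > pi), for a counterclockwise polygon *)
Definition reflex_vertex (V : list point) (i : nat) : Prop :=
  cross (vtx V (i + length V - 1)) (vtx V i) (vtx V (S i)) < 0.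

Definition on_boundary (V : list point) (p : point) : Prop :=
  exists i, (i < length V)%nat /\ on_edge V i p.

(* a radius (in the l1 norm) beyond which everything is outside the polygon *)
Definition poly_bound (V : list point) : R :=
  fold_right (fun v acc => Rabs (fst v) + Rabs (snd v) + acc) 1 V.

Definition path_cont (g : R -> point) : Prop :=
  forall t, continuity_pt (fun s => fst (g s)) t /\
            continuity_pt (fun s => snd (g s)) t.

(* The closed region P bounded by the polygon: the points that cannot be
   joined to far away points by a continuous path avoiding the boundary
   (i.e. the complement of the unbounded component of R^2 minus the boundary). *)
Definition in_poly (V : list point) (p : point) : Prop :=
  forall g : R -> point, path_cont g -> g 0 = p ->
    Rabs (fst (g 1)) + Rabs (snd (g 1)) > poly_bound V ->
    exists t, 0 <= t <= 1 /\ on_boundary V (g t).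

Fixpoint segs_in (V : list point) (a : point) (l : list point) : Prop :=
  match l with
  | [] => True
  | b :: l' => (forall q, on_seg a b q -> in_poly V q) /\ segs_in V b l'
  end.

Fixpoint plen (a : point) (l : list point) : R :=
  match l with
  | [] => 0
  | b :: l' => edist a b + plen b l'
  end.

(* |g(a,b)|: infimum of the lengths of polygonal paths in P from a to b
   (shortest paths in a simple polygon are polygonal, so this is the length
   of the geodesic).  Only meaningful for a, b in P. *)
Definition gdist (V : list point) (a b : point) : R :=
  real (Glb_Rbar (fun L => exists l : list point,
           last l a = b /\ segs_in V a l /\ L = plen a l)).

Definition on_geodesic (V : list point) (x z y : point) : Prop :=
  gdist V x y + gdist V y z = gdist V x z.

Definition general_position (V : list point) (S : list point) : Prop :=
  (forall x y z, In x S -> In y S -> In z S -> x <> y -> y <> z -> x <> z ->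
     ~ on_geodesic V x z y) /\
  (forall c rho p1 p2 p3 p4, in_poly V c ->
     In p1 (S ++ V) -> In p2 (S ++ V) -> In p3 (S ++ V) -> In p4 (S ++ V) ->
     p1 <> p2 -> p1 <> p3 -> p1 <> p4 -> p2 <> p3 -> p2 <> p4 -> p3 <> p4 ->
     ~ (gdist V c p1 = rho /\ gdist V c p2 = rho /\
        gdist V c p3 = rho /\ gdist V c p4 = rho)) /\
  (forall x y i, In x S -> In y S -> x <> y -> (i < length V)%nat ->
     reflex_vertex V i -> ~ on_geodesic V x (vtx V i) y) /\
  (* no geodesic bisector of two points of S passes through a vertex *)
  (forall x y i, In x S -> In y S -> x <> y -> (i < length V)%nat ->
     gdist V x (vtx V i) <> gdist V y (vtx V i)).

Definition count_in_disk (V : list point) (c : point) (rho : R)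
    (S : list point) : nat :=
  length (filter (fun s => if Rle_dec (gdist V c s) rho then true else false) S).

(* Main.v *)
(** It suffices to work in a large triangle, where geodesic disks are Euclidean disks with
    center in the triangle.  The points of [S] form six tiny straight clusters, three red
    and three blue.  A disk that touches the line of a cluster [p] at one of its points
    contains no other point of [p], however small the cluster is.  Hence if the disk that
    touches [p] at its position and passes through the position of [q] avoids the other
    clusters, then any two points of [p] and [q] lie on the boundary of a disk with at
    most [|q| + 1] points of [S].  The positions and directions in [base] and [dir] make
    this work, in one of the two orders, for each of the nine red-blue pairs of clusters,
    except that for one pair the cluster [q] is small and the disk contains one other
    small cluster.  With [k = ceil (n / 5)] it remains to give the two small clusters
    [floor (k / 2)] points and the others at most [k].

    All these conditions are open, so that the points can be moved into general position,
    one at a time, along parabolas. *)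

Require Import Defs.
From Stdlib Require Import Reals Lra Lia Arith List FinFun Classical.
From Coquelicot Require Import Coquelicot.
Import ListNotations.
Open Scope R_scope.

(** * Euclidean geometry *)

Definition vsub (a b : point) : point := (fst a - fst b, snd a - snd b).
Definition dot (a b : point) : R := fst a * fst b + snd a * snd b.
Definition sqd (a b : point) : R := dot (vsub a b) (vsub a b).

Lemma sqd_nonneg (a b : point) : 0 <= sqd a b.
Proof. unfold sqd, dot; nra. Qed.

Lemma edist_sqrt (a b : point) : edist a b = sqrt (sqd a b).
Proof. unfold edist, sqd, dot, vsub; f_equal; simpl; ring. Qed.

Lemma edist_sqr (a b : point) : edist a b * edist a b = sqd a b.
Proof. rewrite edist_sqrt; apply sqrt_sqrt, sqd_nonneg. Qed.

Lemma edist_refl (a : point) : edist a a = 0.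
Proof.
  rewrite edist_sqrt; unfold sqd, dot, vsub; simpl.
  replace (_ + _) with 0 by ring; apply sqrt_0.
Qed.

Lemma edist_triangle (a b c : point) : edist a c <= edist a b + edist b c.
Proof.
  pose proof (triangle (fst a) (snd a) (fst c) (snd c) (fst b) (snd b)) as H.
  unfold dist_euc in H; unfold edist.
  rewrite <- !Rsqr_pow2; exact H.
Qed.

Lemma plen_ge_edist (l : list point) (a : point) : edist a (last l a) <= plen a l.
Proof.
  revert a; induction l as [|b l IH]; intros a.
  - simpl; rewrite edist_refl; lra.
  - replace (last (b :: l) a) with (last l b).
    + simpl plen; pose proof (IH b); pose proof (edist_triangle a b (last l b)); lra.
    + clear IH; revert a b; induction l as [|c l IH]; intros a b; [reflexivity|].
      simpl in *; destruct l; [reflexivity|]; apply IH.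
Qed.

(** Squaring the hypothesis gives equality in Cauchy-Schwarz for [y - x] and [z - y]; Lagrange's
    identity then makes the squared cross product zero. *)
Lemma cross_eq0_of_edist_add (x y z : point) :
  edist x y + edist y z = edist x z -> cross x y z = 0.
Proof.
  intros H.
  pose proof (edist_sqr x y) as Hxy; pose proof (edist_sqr y z) as Hyz.
  pose proof (edist_sqr x z) as Hxz; rewrite <- H in Hxz.
  set (a := edist x y) in *; set (b := edist y z) in *.
  assert (Hdot : a * b = dot (vsub y x) (vsub z y)).
  { unfold sqd, dot, vsub in *; simpl in *; nra. }
  assert (Hc : cross x y z * cross x y z = 0).
  { replace (cross x y z * cross x y z) with
      (sqd x y * sqd y z - dot (vsub y x) (vsub z y) * dot (vsub y x) (vsub z y)).
    - rewrite <- Hdot, <- Hxy, <- Hyz; ring.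
    - unfold cross, sqd, dot, vsub; simpl; ring. }
  destruct (Rmult_integral _ _ Hc); assumption.
Qed.

(* A determinant in [z] that vanishes on the circle through [a], [b], [c]. *)
Definition conc (a b c z : point) : R :=
  sqd b a * cross a c z - sqd c a * cross a b z + sqd z a * cross a b c.

(** For [p] as far from [o] as [a] is, [sqd p a] is linear in [p - a]. Hence the column of squared
    norms in the determinant [conc] depends linearly on the two coordinate columns. *)
Lemma conc_eq0_of_equidistant (o a b c z : point) :
  edist o a = edist o b -> edist o a = edist o c -> edist o a = edist o z ->
  conc a b c z = 0.
Proof.
  intros Hb Hc Hz.
  pose proof (edist_sqr o a) as Ha.
  assert (H : forall p, edist o a = edist o p ->
                sqd p a = 2 * dot (vsub o a) (vsub p a)).
  { intros p Hp; pose proof (edist_sqr o p) as Hq; rewrite <- Hp, Ha in Hq.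
    unfold sqd, dot, vsub in *; simpl in *; lra. }
  unfold conc; rewrite (H b Hb), (H c Hc), (H z Hz).
  unfold cross, dot, vsub; simpl; ring.
Qed.

(** * A triangle as ambient polygon *)

Definition tri : list point := [(-10, -10); (30, -10); (-10, 30)].

Definition in_tri (p : point) : Prop :=
  -10 <= fst p /\ -10 <= snd p /\ fst p + snd p <= 20.

Lemma simple_polygon_tri : simple_polygon tri.
Proof.
  split; [simpl; lia|split; [|split]].
  - unfold tri; repeat constructor; simpl; intros H;
      repeat (destruct H as [H|H]; [injection H; intros; lra|]); exact H.
  - intros i j Hi Hj Hij p [t [Ht Hp]] [s [Hs Hq]].
    assert (Hi' : i = 0%nat \/ i = 1%nat \/ i = 2%nat) by (simpl in Hi; lia).
    assert (Hj' : j = 0%nat \/ j = 1%nat \/ j = 2%nat) by (simpl in Hj; lia).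
    rewrite Hp in Hq.
    destruct Hi' as [->| [->| ->]]; destruct Hj' as [->| [->| ->]]; try lia;
      unfold vtx in *; simpl in *; injection Hq; intros;
      (left; split; [reflexivity|]; rewrite Hp; f_equal; lra) ||
      (right; split; [reflexivity|]; rewrite Hp; f_equal; lra).
  - unfold signed_area2, cross, vtx; simpl; lra.
Qed.

Lemma not_reflex_tri (i : nat) : (i < length tri)%nat -> ~ reflex_vertex tri i.
Proof.
  intros Hi.
  assert (Hi' : i = 0%nat \/ i = 1%nat \/ i = 2%nat) by (simpl in Hi; lia).
  destruct Hi' as [->| [->| ->]]; unfold reflex_vertex, cross, vtx; simpl; lra.
Qed.

Lemma vtx_tri_In (i : nat) : In (vtx tri i) tri.
Proof. apply nth_In, Nat.mod_upper_bound; discriminate. Qed.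

Lemma in_tri_vertex (v : point) : In v tri -> in_tri v.
Proof.
  unfold in_tri; intros [<-|[<-|[<-|[]]]]; simpl; lra.
Qed.

Lemma in_tri_on_boundary (p : point) : on_boundary tri p -> in_tri p.
Proof.
  intros [i [Hi [t [Ht Hp]]]].
  assert (Hi' : i = 0%nat \/ i = 1%nat \/ i = 2%nat) by (simpl in Hi; lia).
  destruct Hi' as [->| [->| ->]]; unfold vtx, in_tri in *; simpl in *;
    rewrite Hp; simpl; lra.
Qed.

Lemma on_boundary_tri (p : point) :
  in_tri p -> fst p + 10 = 0 \/ snd p + 10 = 0 \/ 20 - fst p - snd p = 0 ->
  on_boundary tri p.
Proof.
  destruct p as [x y]; unfold in_tri; simpl; intros [Hx [Hy Hs]] [H|[H|H]].
  - exists 2%nat; split; [simpl; lia|]; exists ((30 - y) / 40); unfold vtx; simpl.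
    split; [lra|f_equal; lra].
  - exists 0%nat; split; [simpl; lia|]; exists ((x + 10) / 40); unfold vtx; simpl.
    split; [lra|f_equal; lra].
  - exists 1%nat; split; [simpl; lia|]; exists ((y + 10) / 40); unfold vtx; simpl.
    split; [lra|f_equal; lra].
Qed.

Lemma poly_bound_tri : poly_bound tri = 101.
Proof.
  unfold poly_bound; simpl.
  rewrite (Rabs_left (-10)), (Rabs_right 30) by lra; lra.
Qed.

Lemma continuity_Rmin (f g : R -> R) :
  continuity f -> continuity g -> continuity (fun t => Rmin (f t) (g t)).
Proof.
  intros Hf Hg t.
  apply (continuity_pt_ext (fun t => (f t + g t - Rabs (f t - g t)) / 2)).
  { intros u; unfold Rmin, Rabs; destruct Rle_dec, Rcase_abs; lra. }
  assert (Habs : continuity_pt (fun t => Rabs (f t - g t)) t).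
  { apply (continuity_pt_comp (fun t => f t - g t) Rabs).
    - apply continuity_pt_minus; auto.
    - apply Rcontinuity_abs. }
  unfold Rdiv; apply continuity_pt_mult; [|apply continuity_pt_const; intros ? ?; reflexivity].
  apply continuity_pt_minus; [apply continuity_pt_plus|]; auto.
Qed.

(** The intermediate value theorem is applied along the path to the least of the three slacks of
    [in_tri]: it is nonnegative at the start and negative at the far end, and where it vanishes the
    path meets the boundary. *)
Lemma in_poly_of_in_tri (p : point) : in_tri p -> in_poly tri p.
Proof.
  intros Hp g Hg H0 H1.
  rewrite poly_bound_tri in H1.
  set (h := fun t => Rmin (Rmin (fst (g t) + 10) (snd (g t) + 10))
                          (20 - fst (g t) - snd (g t))).
  assert (Hc : continuity h).
  { assert (Hx : continuity (fun t => fst (g t))) by (intros t; apply Hg).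
    assert (Hy : continuity (fun t => snd (g t))) by (intros t; apply Hg).
    assert (Hk : forall k, continuity (fun _ : R => k))
      by (intros k; apply continuity_const; intros ? ?; reflexivity).
    apply continuity_Rmin; [apply continuity_Rmin|].
    - apply (continuity_plus _ (fun _ => 10)); auto.
    - apply (continuity_plus _ (fun _ => 10)); auto.
    - apply (continuity_minus (fun t => 20 - fst (g t))); auto.
      apply (continuity_minus (fun _ => 20)); auto. }
  assert (Hh : forall t, h t >= 0 <-> in_tri (g t)).
  { intros t; unfold h, in_tri, Rmin; repeat destruct Rle_dec; lra. }
  assert (h 0 >= 0) by (apply Hh; rewrite H0; exact Hp).
  assert (h 1 < 0).
  { destruct (Rlt_or_le (h 1) 0) as [|Hn]; [assumption|].
    apply Rle_ge, Hh in Hn; unfold in_tri in Hn; revert H1.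
    unfold Rabs; destruct Rcase_abs, Rcase_abs; lra. }
  destruct (IVT_cor h 0 1 Hc) as [t [Ht Hz]]; [lra|nra|].
  exists t; split; [exact Ht|].
  apply on_boundary_tri; [apply Hh; lra|].
  revert Hz; unfold h, Rmin; repeat destruct Rle_dec; lra.
Qed.

(** A point that violates one of the three inequalities escapes along an axis-parallel segment on
    which the same inequality stays violated. *)
Lemma in_tri_of_in_poly (p : point) : in_poly tri p -> in_tri p.
Proof.
  intros H; apply NNPP; intros Hn.
  assert (Hesc : forall u v : R,
    (forall t, 0 <= t <= 1 -> ~ in_tri (fst p + t * u, snd p + t * v)) ->
    Rabs (fst p + u) + Rabs (snd p + v) > 101 -> False).
  { intros u v Hout Hfar.
    destruct (H (fun t => (fst p + t * u, snd p + t * v))) as [t [Ht Hb]].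
    - intros t; simpl; split; reg.
    - destruct p; simpl; f_equal; ring.
    - rewrite poly_bound_tri; simpl; rewrite !Rmult_1_l; exact Hfar.
    - exact (Hout t Ht (in_tri_on_boundary _ Hb)). }
  assert (Ha : forall x, - Rabs x <= x <= Rabs x)
    by (intros x; unfold Rabs; destruct Rcase_abs; lra).
  pose proof (Ha (fst p)) as Hx; pose proof (Ha (snd p)) as Hy.
  pose proof (Rabs_pos (fst p)) as Px; pose proof (Rabs_pos (snd p)) as Py.
  destruct (Rlt_or_le (fst p) (-10)) as [H1|H1];
    [|destruct (Rlt_or_le (snd p) (-10)) as [H2|H2]].
  (* A move by [Rabs (fst p) + 102] ends beyond the bound 101 whatever the sign of the
     coordinate. *)
  - apply (Hesc (- (Rabs (fst p) + 102)) 0).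
    + unfold in_tri; simpl; intros t Ht; nra.
    + pose proof (Rabs_pos (snd p + 0)).
      pose proof (Ha (fst p + - (Rabs (fst p) + 102))); lra.
  - apply (Hesc 0 (- (Rabs (snd p) + 102))).
    + unfold in_tri; simpl; intros t Ht; nra.
    + pose proof (Rabs_pos (fst p + 0)).
      pose proof (Ha (snd p + - (Rabs (snd p) + 102))); lra.
  - apply (Hesc (Rabs (fst p) + 102) 0).
    + unfold in_tri in *; simpl; intros t Ht; nra.
    + pose proof (Rabs_pos (snd p + 0)).
      pose proof (Ha (fst p + (Rabs (fst p) + 102))); lra.
Qed.

Lemma in_tri_on_seg (a b q : point) : in_tri a -> in_tri b -> on_seg a b q -> in_tri q.
Proof.
  unfold in_tri; intros Ha Hb [t [Ht ->]]; simpl; nra.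
Qed.

(** By convexity the segment is an admissible path, and by the triangle inequality no path is
    shorter. *)
Lemma gdist_tri (a b : point) : in_tri a -> in_tri b -> gdist tri a b = edist a b.
Proof.
  intros Ha Hb; unfold gdist.
  rewrite (is_glb_Rbar_unique _ (edist a b)); [reflexivity|]; split.
  - intros L [l [Hl [_ ->]]]; simpl; rewrite <- Hl; apply plen_ge_edist.
  - intros m Hm; apply Hm; exists [b]; split; [reflexivity|split].
    + simpl; split; [|exact I]; intros q Hq.
      exact (in_poly_of_in_tri _ (in_tri_on_seg a b q Ha Hb Hq)).
    + simpl; ring.
Qed.

(** * Small positive parameters *)

(** Validity for all small enough positive parameters; being closed under finite conjunctions, it
    lets one parameter meet finitely many conditions. *)
Definition near0 (P : R -> Prop) : Prop :=
  exists d, 0 < d /\ forall s, 0 < s < d -> P s.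

Lemma near0_true (P : R -> Prop) : (forall s, 0 < s -> P s) -> near0 P.
Proof. intros H; exists 1; split; [lra|]; intros s Hs; apply H; lra. Qed.

Lemma near0_lt (d : R) : 0 < d -> near0 (fun s => s < d).
Proof. intros Hd; exists d; split; [exact Hd|]; intros s Hs; lra. Qed.

Lemma near0_impl (P Q : R -> Prop) :
  (forall s, 0 < s -> P s -> Q s) -> near0 P -> near0 Q.
Proof.
  intros HPQ [d [Hd H]]; exists d; split; [exact Hd|].
  intros s Hs; apply HPQ; [lra|auto].
Qed.

Lemma near0_and (P Q : R -> Prop) :
  near0 P -> near0 Q -> near0 (fun s => P s /\ Q s).
Proof.
  intros [d [Hd H]] [d' [Hd' H']].
  exists (Rmin d d'); split; [apply Rmin_glb_lt; assumption|].
  intros s Hs; pose proof (Rmin_l d d'); pose proof (Rmin_r d d').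
  split; [apply H|apply H']; lra.
Qed.

Lemma near0_cond (A : Prop) (P : R -> Prop) :
  (A -> near0 P) -> near0 (fun s => A -> P s).
Proof.
  intros H; destruct (classic A) as [HA|HA].
  - apply (near0_impl P); auto.
  - apply near0_true; intros s _ HA'; contradiction.
Qed.

Lemma near0_all {A : Type} (L : list A) (P : A -> R -> Prop) :
  (forall a, In a L -> near0 (P a)) -> near0 (fun s => forall a, In a L -> P a s).
Proof.
  induction L as [|x L IH]; intros H.
  - apply near0_true; intros s _ a [].
  - apply (near0_impl (fun s => P x s /\ forall a, In a L -> P a s)).
    + intros s _ [Hx HL] a [<-|Ha]; auto.
    + apply near0_and; [apply H; left; reflexivity|].
      apply IH; intros a Ha; apply H; right; exact Ha.
Qed.

Lemma near0_ex (P : R -> Prop) : near0 P -> exists s, 0 < s /\ P s.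
Proof. intros [d [Hd H]]; exists (d / 2); split; [lra|apply H; lra]. Qed.

Fixpoint peval (l : list R) (s : R) : R :=
  match l with
  | [] => 0
  | a :: l' => a + s * peval l' s
  end.

Lemma peval_bounded (l : list R) :
  exists M, 0 < M /\ forall s, 0 < s < 1 -> Rabs (peval l s) <= M.
Proof.
  induction l as [|a l [M [HM IH]]].
  - exists 1; split; [lra|]; intros s _; simpl; rewrite Rabs_R0; lra.
  - exists (Rabs a + M); split; [pose proof (Rabs_pos a); lra|].
    intros s Hs; simpl; eapply Rle_trans; [apply Rabs_triang|].
    rewrite Rabs_mult, (Rabs_right s) by lra.
    pose proof (IH s Hs); pose proof (Rabs_pos (peval l s)); nra.
Qed.

(** Zero coefficients at the front factor out as powers of [s]; after them the first nonzero
    coefficient dominates the bounded remainder times [s]. *)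
Lemma near0_peval (l : list R) :
  (exists a, In a l /\ a <> 0) -> near0 (fun s => peval l s <> 0).
Proof.
  induction l as [|a l IH]; intros [x [Hx Hx0]]; [destruct Hx|].
  destruct (Req_dec a 0) as [->|Ha].
  - destruct Hx as [Hx|Hx]; [congruence|].
    apply (near0_impl (fun s => peval l s <> 0)); [|apply IH; exists x; auto].
    intros s Hs Hl; simpl; rewrite Rplus_0_l.
    apply Rmult_integral_contrapositive_currified; [lra|exact Hl].
  - destruct (peval_bounded l) as [M [HM HB]].
    apply (near0_impl (fun s => s < 1 /\ s < Rabs a / M)).
    + intros s Hs [H1 H2]; simpl; intros H0.
      assert (Heq : Rabs a = s * Rabs (peval l s)).
      { replace a with (- (s * peval l s)) by lra.
        rewrite Rabs_Ropp, Rabs_mult, (Rabs_right s) by lra; reflexivity. }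
      assert (Hsm : s * M < Rabs a).
      { apply (Rmult_lt_compat_r M) in H2; [|exact HM].
        unfold Rdiv in H2; rewrite Rmult_assoc, Rinv_l in H2 by lra; lra. }
      pose proof (HB s ltac:(lra)); nra.
    + apply near0_and; apply near0_lt; [lra|].
      apply Rdiv_lt_0_compat; [apply Rabs_pos_lt; exact Ha|exact HM].
Qed.

(** * Perturbation into general position *)

Definition close_to (d : R) (a b : point) : Prop :=
  Rabs (fst b - fst a) < d /\ Rabs (snd b - snd a) < d.

(** What a new point must satisfy to preserve [generic]. The condition on [conc] is restricted to
    noncollinear triples, where [cross a b c] is a nonzero leading coefficient. *)
Definition fresh (V S : list point) (z : point) : Prop :=
  (forall a, In a (S ++ V) -> z <> a) /\
  (forall a b, In a (S ++ V) -> In b (S ++ V) -> a <> b -> cross a b z <> 0) /\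
  (forall a b c, In a (S ++ V) -> In b (S ++ V) -> In c (S ++ V) ->
     cross a b c <> 0 -> conc a b c z <> 0) /\
  (forall v y, In v V -> In y S -> sqd z v <> sqd y v).

(* Along the parabola [z0 + (s, s^2)] every condition of [fresh] says that some
   nonzero polynomial of degree at most 4 in [s] does not vanish. *)
Lemma exists_fresh (V S : list point) (z0 : point) (d : R) :
  0 < d -> exists z, close_to d z0 z /\ fresh V S z.
Proof.
  intros Hd.
  set (z := fun s => (fst z0 + s, snd z0 + s * s)).
  assert (H : near0 (fun s => (s < d /\ s < 1) /\ fresh V S (z s))).
  (* The bound [s < 1] controls the second coordinate: [s * s < s < d]. *)
  { apply near0_and; [apply near0_and; apply near0_lt; lra|].
    repeat apply near0_and.
    - apply near0_all; intros a _.
      apply (near0_impl (fun s => peval [fst z0 - fst a; 1] s <> 0)).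
      + intros s _ Hs E; apply Hs; rewrite <- E; unfold z; simpl; ring.
      + apply near0_peval; exists 1; simpl; split; [auto|lra].
    - apply (near0_impl (fun s => forall a, In a (S ++ V) ->
               forall b, In b (S ++ V) -> a <> b -> cross a b (z s) <> 0)); [auto|].
      apply near0_all; intros a _; apply near0_all; intros b _.
      apply near0_cond; intros Hab.
      apply (near0_impl (fun s => peval
               [cross a b z0; snd a - snd b; fst b - fst a] s <> 0)).
      + intros s _ Hs E; apply Hs; rewrite <- E; unfold cross, z; simpl; ring.
      + apply near0_peval.
        destruct (Req_dec (snd a - snd b) 0) as [Hy|Hy].
        * exists (fst b - fst a); split; [simpl; auto|]; intros Hx; apply Hab.
          destruct a, b; simpl in *; f_equal; lra.
        * exists (snd a - snd b); split; [simpl; auto|exact Hy].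
    - apply (near0_impl (fun s => forall a, In a (S ++ V) ->
               forall b, In b (S ++ V) -> forall c, In c (S ++ V) ->
               cross a b c <> 0 -> conc a b c (z s) <> 0)); [auto|].
      apply near0_all; intros a _; apply near0_all; intros b _.
      apply near0_all; intros c _; apply near0_cond; intros Hc.
      apply (near0_impl (fun s => peval
               [conc a b c z0;
                sqd b a * (snd a - snd c) - sqd c a * (snd a - snd b)
                  + 2 * (fst z0 - fst a) * cross a b c;
                sqd b a * (fst c - fst a) - sqd c a * (fst b - fst a)
                  + (1 + 2 * (snd z0 - snd a)) * cross a b c;
                0; cross a b c] s <> 0)).
      + intros s _ Hs E; apply Hs; transitivity (conc a b c (z s)); [|exact E].
        unfold conc, cross, sqd, dot, vsub, z; simpl; ring.
      + apply near0_peval; exists (cross a b c); split; [simpl; tauto|exact Hc].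
    - apply (near0_impl (fun s => forall v, In v V ->
               forall y, In y S -> sqd (z s) v <> sqd y v)); [auto|].
      apply near0_all; intros v _; apply near0_all; intros y _.
      apply (near0_impl (fun s => peval
               [sqd z0 v - sqd y v; 2 * (fst z0 - fst v);
                1 + 2 * (snd z0 - snd v); 0; 1] s <> 0)).
      + intros s _ Hs E; apply Hs.
        transitivity (sqd (z s) v - sqd y v); [|rewrite E; ring].
        unfold sqd, dot, vsub, z; simpl; ring.
      + apply near0_peval; exists 1; split; [simpl; tauto|lra]. }
  destruct (near0_ex _ H) as [s [Hs [[Hsd Hs1] Hf]]].
  exists (z s); split; [|exact Hf].
  unfold close_to, z; simpl; split; rewrite Rabs_right; nra.
Qed.

(** A determinant form of general position that can be built up point by point. Collinearity is
    excluded for vertices too, so that every triple qualifies for the [conc] clause of [fresh]. *)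
Definition generic (V S : list point) : Prop :=
  NoDup S /\
  (forall a b c, In a (S ++ V) -> In b (S ++ V) -> In c (S ++ V) ->
     a <> b -> a <> c -> b <> c -> cross a b c <> 0) /\
  (forall a b c e, In a (S ++ V) -> In b (S ++ V) -> In c (S ++ V) -> In e (S ++ V) ->
     a <> b -> a <> c -> a <> e -> b <> c -> b <> e -> c <> e -> conc a b c e <> 0) /\
  (forall v x y, In v V -> In x S -> In y S -> x <> y -> sqd x v <> sqd y v).

(** [cross] and [conc] only change sign under permutations of their arguments, so the new point can
    always be moved to the last place, where [fresh] applies. *)
Lemma generic_cons (V S : list point) (z : point) :
  generic V S -> fresh V S z -> generic V (z :: S).
Proof.
  intros [HN [H3 [H4 HV]]] [F1 [F2 [F3 F4]]].
  repeat split.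
  - constructor; [|exact HN]; intros Hz; apply (F1 z); [|reflexivity].
    apply in_or_app; left; exact Hz.
  - intros a b c [<-|Ha] [<-|Hb] [<-|Hc] Hab Hac Hbc; try congruence.
    + replace (cross z b c) with (cross b c z) by (unfold cross; ring); auto.
    + replace (cross a z c) with (- cross a c z) by (unfold cross; ring).
      apply Ropp_neq_0_compat; auto.
    + auto.
    + auto.
  - intros a b c e [<-|Ha] [<-|Hb] [<-|Hc] [<-|He] Hab Hac Hae Hbc Hbe Hce;
      try congruence.
    + replace (conc z b c e) with (- conc b c e z)
        by (unfold conc, cross, sqd, dot, vsub; simpl; ring).
      apply Ropp_neq_0_compat; auto.
    + replace (conc a z c e) with (conc a c e z)
        by (unfold conc, cross, sqd, dot, vsub; simpl; ring); auto.
    + replace (conc a b z e) with (- conc a b e z)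
        by (unfold conc, cross, sqd, dot, vsub; simpl; ring).
      apply Ropp_neq_0_compat; auto.
    + auto.
    + auto.
  - intros v x y Hv [<-|Hx] [<-|Hy] Hxy; try congruence.
    + auto.
    + apply not_eq_sym; auto.
    + auto.
Qed.

(** Induction on the indices: each new point is placed near its target, fresh for the points already
    placed, which stay fixed. *)
Lemma generic_perturbation {I : Type} (eqd : forall i j : I, {i = j} + {i <> j})
    (V : list point) (idx : list I) (T : I -> point) (d : R) :
  generic V [] -> 0 < d -> NoDup idx ->
  exists X : I -> point,
    (forall i, In i idx -> close_to d (T i) (X i)) /\ generic V (map X idx).
Proof.
  intros HV Hd; induction idx as [|i idx IH]; intros HN.
  - exists T; split; [intros i []|exact HV].
  - inversion HN as [|? ? Hi HN']; subst.
    destruct (IH HN') as [X [HX HG]].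
    destruct (exists_fresh V (map X idx) (T i) d Hd) as [z [Hz HF]].
    assert (Hext : map (fun j => if eqd j i then z else X j) idx = map X idx).
    { apply map_ext_in; intros j Hj; destruct (eqd j i); congruence. }
    exists (fun j => if eqd j i then z else X j); split.
    + intros j [<-|Hj]; [destruct (eqd i i); congruence|].
      destruct (eqd j i) as [->|]; auto.
    + simpl; rewrite Hext; destruct (eqd i i) as [_|]; [|congruence].
      apply generic_cons; assumption.
Qed.

Lemma generic_tri : generic tri [].
Proof.
  repeat split.
  - constructor.
  - simpl; intros a b c Ha Hb Hc Hab Hac Hbc.
    repeat match goal with H : _ \/ _ |- _ => destruct H | H : False |- _ => destruct H end;
      subst; try congruence; unfold cross; simpl; lra.
  - simpl; intros a b c e Ha Hb Hc He Hab Hac Hae Hbc Hbe Hce.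
    repeat match goal with H : _ \/ _ |- _ => destruct H | H : False |- _ => destruct H end;
      subst; congruence.
  - intros v x y _ [].
Qed.

(** With Euclidean distances, a point on a geodesic makes [cross] vanish and four points on a circle
    make [conc] vanish; a triangle has no reflex vertices. *)
Lemma general_position_tri (S : list point) :
  (forall x, In x S -> in_tri x) -> generic tri S -> general_position tri S.
Proof.
  intros HS [_ [H3 [H4 HV]]].
  assert (HL : forall x, In x (S ++ tri) -> in_tri x).
  { intros x Hx; apply in_app_or in Hx as [Hx|Hx]; [auto|apply in_tri_vertex; exact Hx]. }
  repeat split.
  - intros x y z Hx Hy Hz Hxy Hyz Hxz H; unfold on_geodesic in H.
    rewrite !gdist_tri in H by auto.
    apply (H3 x y z); try (apply in_or_app; left); auto.
    apply cross_eq0_of_edist_add, H.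
  - intros c rho a b p q Hc Ha Hb Hp Hq D1 D2 D3 D4 D5 D6 [Ea [Eb [Ep Eq]]].
    apply in_tri_of_in_poly in Hc.
    rewrite gdist_tri in Ea, Eb, Ep, Eq by auto.
    apply (H4 a b p q); auto.
    apply (conc_eq0_of_equidistant c); congruence.
  - intros x y i _ _ _ Hi Hr; exfalso; exact (not_reflex_tri i Hi Hr).
  - intros x y i Hx Hy Hxy _ H.
    pose proof (vtx_tri_In i) as Hv.
    rewrite !gdist_tri in H by (auto using in_tri_vertex).
    apply (HV (vtx tri i) x y Hv Hx Hy Hxy).
    rewrite <- !edist_sqr; congruence.
Qed.

(** * Continuity in three points *)

Lemma close_trans (d d' : R) (a b c : point) :
  close_to d a b -> close_to d' b c -> close_to (d + d') a c.
Proof.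
  intros [H1 H2] [H3 H4]; split.
  - replace (fst c - fst a) with ((fst b - fst a) + (fst c - fst b)) by ring.
    eapply Rle_lt_trans; [apply Rabs_triang|lra].
  - replace (snd c - snd a) with ((snd b - snd a) + (snd c - snd b)) by ring.
    eapply Rle_lt_trans; [apply Rabs_triang|lra].
Qed.

Lemma close_weaken (d d' : R) (a b : point) : d <= d' -> close_to d a b -> close_to d' a b.
Proof. intros Hd [H1 H2]; split; lra. Qed.

Definition cont3 (f : point -> point -> point -> R) : Prop :=
  forall r b z eps, 0 < eps ->
  near0 (fun d => forall r' b' z', close_to d r r' -> close_to d b b' -> close_to d z z' ->
    Rabs (f r' b' z' - f r b z) < eps).

Lemma cont3_const (k : R) : cont3 (fun _ _ _ => k).
Proof.
  intros r b z eps He; apply near0_true; intros d _ r' b' z' _ _ _.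
  rewrite Rminus_diag, Rabs_R0; exact He.
Qed.

Lemma cont3_coords :
  (cont3 (fun r _ _ => fst r) /\ cont3 (fun r _ _ => snd r)) /\
  (cont3 (fun _ b _ => fst b) /\ cont3 (fun _ b _ => snd b)) /\
  (cont3 (fun _ _ z => fst z) /\ cont3 (fun _ _ z => snd z)).
Proof.
  repeat split; intros r b z eps He;
    apply (near0_impl (fun d => d < eps)); try (apply near0_lt; exact He);
    intros d _ Hd r' b' z' [? ?] [? ?] [? ?]; lra.
Qed.

Lemma cont3_plus (f g : point -> point -> point -> R) :
  cont3 f -> cont3 g -> cont3 (fun r b z => f r b z + g r b z).
Proof.
  intros Hf Hg r b z eps He.
  eapply near0_impl;
    [|exact (near0_and _ _ (Hf r b z (eps / 2) ltac:(lra)) (Hg r b z (eps / 2) ltac:(lra)))].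
  intros d _ [H1 H2] r' b' z' Hr Hb Hz.
  specialize (H1 r' b' z' Hr Hb Hz); specialize (H2 r' b' z' Hr Hb Hz).
  replace (_ - _) with ((f r' b' z' - f r b z) + (g r' b' z' - g r b z)) by ring.
  eapply Rle_lt_trans; [apply Rabs_triang|lra].
Qed.

Lemma cont3_mult (f g : point -> point -> point -> R) :
  cont3 f -> cont3 g -> cont3 (fun r b z => f r b z * g r b z).
Proof.
  intros Hf Hg r b z eps He.
  set (F := f r b z); set (G := g r b z); set (M := 1 + Rabs F + Rabs G).
  assert (HM : 0 < M) by (unfold M; pose proof (Rabs_pos F); pose proof (Rabs_pos G); lra).
  (* If both factors have errors [u], [v] below [eta <= 1], the error [u * v + F * v + G * u] of the
     product is below [eta * M]. *)
  set (eta := Rmin 1 (eps / M)).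
  assert (Heta : 0 < eta)
    by (apply Rmin_glb_lt; [lra|apply Rdiv_lt_0_compat; assumption]).
  assert (Heta1 : eta <= 1) by apply Rmin_l.
  assert (HetaM : eta * M <= eps).
  { apply Rle_trans with (eps / M * M).
    - apply Rmult_le_compat_r; [lra|apply Rmin_r].
    - unfold Rdiv; rewrite Rmult_assoc, Rinv_l by lra; lra. }
  eapply near0_impl;
    [|exact (near0_and _ _ (Hf r b z eta Heta) (Hg r b z eta Heta))].
  intros d _ [H1 H2] r' b' z' Hr Hb Hz.
  specialize (H1 r' b' z' Hr Hb Hz); specialize (H2 r' b' z' Hr Hb Hz).
  fold F in H1; fold G in H2.
  set (u := f r' b' z' - F) in *; set (v := g r' b' z' - G) in *.
  replace (f r' b' z' * g r' b' z' - F * G) with (u * v + F * v + G * u)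
    by (unfold u, v; ring).
  apply Rle_lt_trans with (Rabs u * Rabs v + Rabs F * Rabs v + Rabs G * Rabs u).
  - rewrite <- !Rabs_mult; eapply Rle_trans; [apply Rabs_triang|].
    apply Rplus_le_compat_r, Rabs_triang.
  - pose proof (Rabs_pos u); pose proof (Rabs_pos v);
      pose proof (Rabs_pos F); pose proof (Rabs_pos G); unfold M in HetaM; nra.
Qed.

Lemma cont3_minus (f g : point -> point -> point -> R) :
  cont3 f -> cont3 g -> cont3 (fun r b z => f r b z - g r b z).
Proof.
  intros Hf Hg.
  assert (Hn : cont3 (fun r b z => -1 * g r b z))
    by (apply cont3_mult; [apply cont3_const|exact Hg]).
  intros r b z eps He.
  eapply near0_impl; [|exact (cont3_plus _ _ Hf Hn r b z eps He)].
  intros d _ H r' b' z' Hr Hb Hz.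
  replace (_ - _) with
    (f r' b' z' + -1 * g r' b' z' - (f r b z + -1 * g r b z)) by ring; auto.
Qed.

Lemma cont3_pos (f : point -> point -> point -> R) (r b z : point) :
  cont3 f -> 0 < f r b z ->
  near0 (fun d => forall r' b' z', close_to d r r' -> close_to d b b' -> close_to d z z' ->
    0 < f r' b' z').
Proof.
  intros Hf Hp; eapply near0_impl; [|exact (Hf r b z _ Hp)].
  intros d _ H r' b' z' Hr Hb Hz; specialize (H r' b' z' Hr Hb Hz).
  apply Rabs_def2 in H; lra.
Qed.

Ltac cont3_auto :=
  unfold sqd, dot, vsub; simpl;
  repeat first [apply cont3_minus | apply cont3_plus | apply cont3_mult
               | apply cont3_const | apply cont3_coords].

(** * Disks touching a line *)

(** The point [r + t E] equidistant from [r] and [b]: this means [sqd b r = 2 t (E . (b - r))]. *)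
Definition center (E r b : point) : point :=
  (fst r + sqd b r / (2 * dot E (vsub b r)) * fst E,
   snd r + sqd b r / (2 * dot E (vsub b r)) * snd E).

(* Positive exactly when [z] lies outside the disk through [r] and [b] whose center
   lies on the ray from [r] in direction [E] (provided [E . (b - r) > 0]). *)
Definition outside (E r b z : point) : R :=
  sqd z r * dot E (vsub b r) - sqd b r * dot E (vsub z r).

(** Identifies [outside] as the power of [z] with respect to the circle, cleared of its
    denominator. *)
Lemma sqd_center (E r b z : point) :
  dot E (vsub b r) <> 0 ->
  (sqd (center E r b) z - sqd (center E r b) r) * dot E (vsub b r) = outside E r b z.
Proof.
  intros Hd; unfold outside.
  transitivity (sqd z r * dot E (vsub b r)
    - 2 * (sqd b r / (2 * dot E (vsub b r)) * dot E (vsub b r)) * dot E (vsub z r)).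
  - set (s := sqd b r / (2 * dot E (vsub b r))).
    unfold center; fold s; unfold sqd, dot, vsub; simpl; ring.
  - field; exact Hd.
Qed.

Lemma edist_center (E r b : point) :
  dot E (vsub b r) <> 0 -> edist (center E r b) b = edist (center E r b) r.
Proof.
  intros Hd; rewrite !edist_sqrt; f_equal.
  pose proof (sqd_center E r b b Hd) as H; unfold outside in H.
  rewrite Rminus_diag in H; apply Rmult_integral in H as [H|H]; [lra|contradiction].
Qed.

Lemma edist_center_lt (E r b z : point) :
  0 < dot E (vsub b r) -> 0 < outside E r b z ->
  edist (center E r b) r < edist (center E r b) z.
Proof.
  intros Hd Hz; rewrite !edist_sqrt; apply sqrt_lt_1; try apply sqd_nonneg.
  rewrite <- (sqd_center E r b z) in Hz by lra; nra.
Qed.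

(* If [E] is normal to [u], the disk touches the line through [r] in direction [u]. *)
Lemma outside_tangent (E r b u : point) (s : R) :
  dot E u = 0 ->
  outside E r b (fst r + s * fst u, snd r + s * snd u)
    = s * s * dot u u * dot E (vsub b r).
Proof.
  intros Hu; unfold outside.
  transitivity (s * s * dot u u * dot E (vsub b r) - sqd b r * (s * dot E u)).
  - unfold sqd, dot, vsub; simpl; ring.
  - rewrite Hu; ring.
Qed.

(** The inequalities of [in_tri] for the center, made strict and multiplied by
    [2 * dot E (vsub b r)]: polynomial open conditions on [r] and [b]. *)
Definition center_inside (E r b : point) : Prop :=
  0 < 2 * dot E (vsub b r) * (fst r + 10) + sqd b r * fst E /\
  0 < 2 * dot E (vsub b r) * (snd r + 10) + sqd b r * snd E /\
  0 < 2 * dot E (vsub b r) * (20 - fst r - snd r) - sqd b r * (fst E + snd E).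

Lemma in_tri_center (E r b : point) :
  0 < dot E (vsub b r) -> center_inside E r b -> in_tri (center E r b).
Proof.
  unfold center_inside, in_tri, center; simpl.
  set (d := dot E (vsub b r)); set (q := sqd b r); intros Hd [H1 [H2 H3]].
  assert (Hq : q / (2 * d) * (2 * d) = q) by (field; lra).
  set (s := q / (2 * d)) in *; rewrite <- Hq in H1, H2, H3.
  repeat split; nra.
Qed.

(** * The clusters *)

(* Found by computer search; clusters 0, 1, 2 are red, 3, 4, 5 are blue, and 2 and 5 are
   the small ones. *)
Definition base (l : nat) : point :=
  nth l [(-3, -2); (3, 2); (0, 1); (-1, 2); (1, -3); (0, 0)] (0, 0).

(** The default is a nonzero vector with coordinates at most 1, so that [dir_pos] and [dir_le1] hold
    for every [l]. *)
Definition dir (l : nat) : point :=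
  nth l [(0, 1); (1, 0); (1, 0); (1, -1); (1, 0); (0, 1)] (0, 1).

Definition target (e : R) (lk : nat * nat) : point :=
  (fst (base (fst lk)) + e * INR (snd lk) * fst (dir (fst lk)),
   snd (base (fst lk)) + e * INR (snd lk) * snd (dir (fst lk))).

(* [(p, q, E, out)]: the disks that touch cluster [p] at one of its points, have
   their center on the side [E] of it and pass through a point of cluster [q];
   they avoid the clusters listed in [out]. *)
Definition disk_family : Type := (nat * nat * point * list nat)%type.

(** One entry per red-blue pair of clusters. Only the disk for 4 and 2 contains a third cluster,
    namely 5. *)
Definition families : list disk_family :=
  [((3, 0)%nat, (-1, -1), [1; 2; 4; 5]%nat); ((0, 4)%nat, (1, 0), [1; 2; 3; 5]%nat);
   ((5, 0)%nat, (-1, 0), [1; 2; 3; 4]%nat); ((3, 1)%nat, (1, 1), [0; 2; 4; 5]%nat);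
   ((1, 4)%nat, (0, -1), [0; 2; 3; 5]%nat); ((5, 1)%nat, (1, 0), [0; 2; 3; 4]%nat);
   ((2, 3)%nat, (0, 1), [0; 1; 4; 5]%nat); ((4, 2)%nat, (0, 1), [0; 1; 3]%nat);
   ((2, 5)%nat, (0, -1), [0; 1; 3; 4]%nat)].

Definition family_ok (p q : nat) (E : point) (out : list nat) : Prop :=
  dot E (dir p) = 0 /\
  0 < dot E (vsub (base q) (base p)) /\
  center_inside E (base p) (base q) /\
  forall l, In l out -> 0 < outside E (base p) (base q) (base l).

Lemma families_ok (p q : nat) (E : point) (out : list nat) :
  In (p, q, E, out) families -> family_ok p q E out.
Proof.
  intros H; unfold families in H; simpl in H.
  repeat (destruct H as [H|H];
    [injection H as <- <- <- <-; unfold family_ok, center_inside, outside, sqd, dot, vsub;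
     simpl; repeat split; try lra;
     intros l Hl; repeat (destruct Hl as [<-|Hl]; [simpl; lra|]); destruct Hl|]).
  destruct H.
Qed.

Lemma dir_pos (l : nat) : 0 < dot (dir l) (dir l).
(* Six entries and one more case, because [nth] on the empty list still inspects the index. *)
Proof. do 7 (destruct l as [|l]; [unfold dot; simpl; lra|]); unfold dot; simpl; lra. Qed.

Lemma dir_le1 (l : nat) : Rabs (fst (dir l)) <= 1 /\ Rabs (snd (dir l)) <= 1.
Proof.
  do 7 (destruct l as [|l];
    [simpl; split; unfold Rabs; destruct Rcase_abs; lra|]);
  simpl; split; unfold Rabs; destruct Rcase_abs; lra.
Qed.

Lemma in_tri_near_base (l : nat) (x : point) : close_to 1 (base l) x -> in_tri x.
Proof.
  intros [H1 H2]; apply Rabs_def2 in H1, H2; unfold in_tri.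
  do 7 (destruct l as [|l]; [simpl in *; lra|]); simpl in *; lra.
Qed.

Lemma target_close (e d : R) (N l k : nat) :
  0 < e -> e * INR N < d -> (k < N)%nat -> close_to d (base l) (target e (l, k)).
Proof.
  intros He Hd Hk; apply lt_INR in Hk; pose proof (pos_INR k).
  destruct (dir_le1 l) as [Hx Hy]; unfold close_to, target; simpl.
  assert (Hek : 0 <= e * INR k < d) by nra.
  split; rewrite Rplus_comm; unfold Rminus; rewrite Rplus_assoc, Rplus_opp_r, Rplus_0_r,
    Rabs_mult, (Rabs_right (e * INR k)) by lra; nra.
Qed.

(** Apart from the tangency, the conditions in [family_ok] are strict and continuous, hence persist
    nearby. *)
Lemma family_near (p q : nat) (E : point) (out : list nat) :
  family_ok p q E out ->
  near0 (fun d => forall r b, close_to d (base p) r -> close_to d (base q) b ->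
    0 < dot E (vsub b r) /\ center_inside E r b /\
    forall l z, In l out -> close_to d (base l) z -> 0 < outside E r b z).
Proof.
  intros [_ [Hd [[H1 [H2 H3]] Hout]]].
  (* The third point is a dummy here and in the next three conditions. *)
  assert (A0 := cont3_pos (fun r b _ => dot E (vsub b r))
                  (base p) (base q) (base p) ltac:(cont3_auto) Hd).
  assert (A1 := cont3_pos
    (fun r b _ => 2 * dot E (vsub b r) * (fst r + 10) + sqd b r * fst E)
    (base p) (base q) (base p) ltac:(cont3_auto) H1).
  assert (A2 := cont3_pos
    (fun r b _ => 2 * dot E (vsub b r) * (snd r + 10) + sqd b r * snd E)
    (base p) (base q) (base p) ltac:(cont3_auto) H2).
  assert (A3 := cont3_pos
    (fun r b _ => 2 * dot E (vsub b r) * (20 - fst r - snd r)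
                  - sqd b r * (fst E + snd E))
    (base p) (base q) (base p) ltac:(cont3_auto) H3).
  assert (A4 : near0 (fun d => forall l, In l out -> forall r b z,
    close_to d (base p) r -> close_to d (base q) b -> close_to d (base l) z ->
    0 < outside E r b z)).
  { apply near0_all; intros l Hl.
    apply (cont3_pos (outside E)); [unfold outside; cont3_auto|auto]. }
  eapply near0_impl;
    [|exact (near0_and _ _ A0 (near0_and _ _ A1
        (near0_and _ _ A2 (near0_and _ _ A3 A4))))].
  intros d _ [B0 [B1 [B2 [B3 B4]]]] r b Hr Hb.
  repeat split; eauto.
Qed.

(** Points of one cluster merge as [e] tends to 0, so continuity at the base positions says nothing;
    the exact tangency formula gives a positive value for each [e]. *)
Lemma outside_targets (p q : nat) (E : point) (out : list nat) (e d : R) (N i j k : nat) :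
  family_ok p q E out ->
  (forall r b, close_to d (base p) r -> close_to d (base q) b -> 0 < dot E (vsub b r)) ->
  0 < e -> e * INR N < d -> (i < N)%nat -> (j < N)%nat -> i <> k ->
  0 < outside E (target e (p, i)) (target e (q, j)) (target e (p, k)).
Proof.
  intros [HE _] Hpos He HeN Hi Hj Hik.
  set (r := target e (p, i)).
  replace (target e (p, k)) with
    (fst r + e * (INR k - INR i) * fst (dir p), snd r + e * (INR k - INR i) * snd (dir p))
    by (unfold r, target; simpl; f_equal; ring).
  rewrite outside_tangent by exact HE.
  assert (HINR : INR k - INR i <> 0).
  { intros H; apply Hik, INR_eq; lra. }
  apply Rmult_lt_0_compat; [apply Rmult_lt_0_compat|].
  - apply Rsqr_pos_lt, Rmult_integral_contrapositive_currified; [lra|exact HINR].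
  - apply dir_pos.
  - apply Hpos; apply target_close with N; assumption.
Qed.

(** Three scales are fixed in turn: [d] for the conditions between clusters, then the spacing [e]
    keeping targets within [d / 2] of their bases, then the perturbation [d']. *)
Lemma clusters_exist (N : nat) (idx : list (nat * nat)) :
  NoDup idx -> (forall l k, In (l, k) idx -> (k < N)%nat) ->
  exists X : nat * nat -> point,
    generic tri (map X idx) /\
    (forall i, In i idx -> in_tri (X i)) /\
    forall p q E out i j, In (p, q, E, out) families ->
      In (p, i) idx -> In (q, j) idx ->
      let r := X (p, i) in let b := X (q, j) in
      0 < dot E (vsub b r) /\ in_tri (center E r b) /\
      (forall l k, In l out -> In (l, k) idx -> 0 < outside E r b (X (l, k))) /\
      (forall k, i <> k -> In (p, k) idx -> 0 < outside E r b (X (p, k))).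
Proof.
  intros HN Hidx.
  set (Q := fun (s : disk_family) (d : R) => let '(p, q, E, out) := s in
    forall r b, close_to d (base p) r -> close_to d (base q) b ->
    0 < dot E (vsub b r) /\ center_inside E r b /\
    forall l z, In l out -> close_to d (base l) z -> 0 < outside E r b z).
  assert (HQ : near0 (fun d => d < 1 /\ forall s, In s families -> Q s d)).
  { apply near0_and; [apply near0_lt; lra|].
    apply near0_all; intros [[[p q] E] out] Hs.
    apply family_near, families_ok, Hs. }
  destruct (near0_ex _ HQ) as [d [Hd [Hd1 HQd]]]; clear HQ.
  assert (He : exists e, 0 < e /\ e * INR N < d / 2).
  { exists (d / 2 / (INR N + 1)); pose proof (pos_INR N).
    assert (0 < d / 2 / (INR N + 1)) by (apply Rdiv_lt_0_compat; lra).
    split; [assumption|].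
    assert (d / 2 / (INR N + 1) * (INR N + 1) = d / 2) by (field; lra).
    nra. }
  destruct He as [e [He HeN]].
  (* This scale must come after [e]: the values within a cluster are positive but of order
     [e * e]. *)
  assert (HT : near0 (fun d' => d' < d / 2 /\
    forall s, In s families -> forall i, In i (seq 0 N) -> forall j, In j (seq 0 N) ->
    forall k, In k (seq 0 N) -> i <> k ->
    let '(p, q, E, out) := s in
    forall r b z, close_to d' (target e (p, i)) r -> close_to d' (target e (q, j)) b ->
      close_to d' (target e (p, k)) z -> 0 < outside E r b z)).
  { apply near0_and; [apply near0_lt; lra|].
    apply near0_all; intros [[[p q] E] out] Hs.
    apply near0_all; intros i Hi; apply near0_all; intros j Hj.
    apply near0_all; intros k Hk; apply near0_cond; intros Hik.
    apply in_seq in Hi, Hj.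
    apply (cont3_pos (outside E)); [unfold outside; cont3_auto|].
    apply (outside_targets p q E out e d N); try lia; try lra.
    - apply families_ok, Hs.
    - intros r b Hr Hb; exact (proj1 (HQd _ Hs r b Hr Hb)). }
  destruct (near0_ex _ HT) as [d' [Hd' [Hdd HTd]]]; clear HT.
  assert (eqd : forall i j : nat * nat, {i = j} + {i <> j})
    by (decide equality; apply Nat.eq_dec).
  destruct (generic_perturbation eqd tri idx (target e) d' generic_tri Hd' HN)
    as [X [HX HG]].
  assert (Hbase : forall l k, In (l, k) idx -> close_to d (base l) (X (l, k))).
  { intros l k Hlk; apply close_weaken with (d / 2 + d'); [lra|].
    apply close_trans with (target e (l, k)); [|auto].
    apply target_close with N; eauto. }
  exists X; split; [exact HG|split].
  - intros [l k] Hlk; apply in_tri_near_base with l, close_weaken with d; [lra|auto].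
  - intros p q E out i j Hs Hi Hj r b.
    destruct (HQd _ Hs r b (Hbase _ _ Hi) (Hbase _ _ Hj)) as [H1 [H2 H3]].
    split; [exact H1|split; [apply in_tri_center; assumption|split]].
    + intros l k Hl Hlk; apply (H3 l); auto.
    + intros k Hik Hk.
      assert (Hin : forall l k', In (l, k') idx -> In k' (seq 0 N))
        by (intros l k' Hlk; apply in_seq; apply Hidx in Hlk; lia).
      refine (HTd _ Hs i (Hin _ _ Hi) j (Hin _ _ Hj) k (Hin _ _ Hk) Hik r b _ _ _ _);
        apply HX; assumption.
Qed.

(** * Counting *)

Lemma count_in_disk_app (V : list point) (c : point) (rho : R) (S S' : list point) :
  count_in_disk V c rho (S ++ S')
    = (count_in_disk V c rho S + count_in_disk V c rho S')%nat.
Proof. unfold count_in_disk; rewrite filter_app, length_app; reflexivity. Qed.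

Lemma count_in_disk_le (V : list point) (c : point) (rho : R) (S : list point) :
  (count_in_disk V c rho S <= length S)%nat.
Proof. apply filter_length_le. Qed.

Lemma length_filter_map {A B : Type} (f : B -> bool) (g : A -> B) (L : list A) :
  length (filter f (map g L)) = length (filter (fun x => f (g x)) L).
Proof.
  induction L as [|x L IH]; [reflexivity|].
  simpl; destruct (f (g x)); simpl; congruence.
Qed.

(** Counting takes place on indices: the filtered index list has no repetition and is included in
    [[x]]. *)
Lemma count_in_disk_le1 {A : Type} (V : list point) (c : point) (rho : R)
    (X : A -> point) (L : list A) (x : A) :
  NoDup L -> (forall y, In y L -> x <> y -> rho < gdist V c (X y)) ->
  (count_in_disk V c rho (map X L) <= 1)%nat.
Proof.
  intros HN H; change 1%nat with (length [x]); unfold count_in_disk.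
  rewrite length_filter_map.
  apply NoDup_incl_length; [apply NoDup_filter; exact HN|].
  intros y Hy; apply filter_In in Hy as [Hy Hr]; left.
  destruct (Rle_dec (gdist V c (X y)) rho) as [Hle|]; [|discriminate].
  apply NNPP; intros Hn; pose proof (H y Hy Hn); lra.
Qed.

Lemma count_in_disk_0 (V : list point) (c : point) (rho : R) (S : list point) :
  (forall z, In z S -> rho < gdist V c z) -> count_in_disk V c rho S = 0%nat.
Proof.
  unfold count_in_disk; induction S as [|x S IH]; intros H; [reflexivity|].
  simpl; destruct (Rle_dec (gdist V c x) rho) as [Hle|].
  - pose proof (H x (or_introl eq_refl)); lra.
  - apply IH; intros z Hz; apply H; right; exact Hz.
Qed.

Definition cluster (w : nat -> nat) (l : nat) : list (nat * nat) :=
  map (pair l) (seq 0 (w l)).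

Definition red_idx (w : nat -> nat) : list (nat * nat) :=
  (cluster w 0 ++ cluster w 1 ++ cluster w 2)%list.

Definition blue_idx (w : nat -> nat) : list (nat * nat) :=
  (cluster w 3 ++ cluster w 4 ++ cluster w 5)%list.

Lemma in_cluster (w : nat -> nat) (l : nat) (x : nat * nat) :
  In x (cluster w l) <-> exists k, x = (l, k) /\ (k < w l)%nat.
Proof.
  unfold cluster; rewrite in_map_iff; split.
  - intros [k [<- Hk]]; apply in_seq in Hk; exists k; split; [reflexivity|lia].
  - intros [k [-> Hk]]; exists k; split; [reflexivity|apply in_seq; lia].
Qed.

Lemma NoDup_cluster (w : nat -> nat) (l : nat) : NoDup (cluster w l).
Proof.
  apply Injective_map_NoDup; [intros i j H; congruence|apply seq_NoDup].
Qed.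

Lemma in_idx (w : nat -> nat) (x : nat * nat) :
  In x (red_idx w ++ blue_idx w) <->
  In x (cluster w 0) \/ In x (cluster w 1) \/ In x (cluster w 2) \/
  In x (cluster w 3) \/ In x (cluster w 4) \/ In x (cluster w 5).
Proof. unfold red_idx, blue_idx; rewrite !in_app_iff; tauto. Qed.

Lemma NoDup_idx (w : nat -> nat) : NoDup (red_idx w ++ blue_idx w).
Proof.
  unfold red_idx, blue_idx; rewrite <- !app_assoc.
  repeat (apply NoDup_app; [apply NoDup_cluster| |]); [apply NoDup_cluster|..];
    intros x Hx Hy; rewrite ?in_app_iff in Hy; rewrite !in_cluster in Hy;
    apply in_cluster in Hx as [k [-> _]];
    repeat (destruct Hy as [Hy|Hy]); destruct Hy as [k' [Hy _]]; congruence.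
Qed.

Lemma cluster_incl_idx (w : nat -> nat) (l : nat) :
  (l < 6)%nat -> incl (cluster w l) (red_idx w ++ blue_idx w).
Proof.
  intros Hl x Hx; apply in_idx.
  do 6 (destruct l as [|l]; [tauto|]); lia.
Qed.

(** Bounds the part of cluster [l] in a disk touching cluster [p]: the touching point alone,
    nothing, or at worst the whole cluster. *)
Definition cluster_bound (w : nat -> nat) (p : nat) (out : list nat) (l : nat) : nat :=
  if Nat.eqb l p then 1%nat else if existsb (Nat.eqb l) out then 0%nat else w l.

Lemma clusters_with_disks (w : nat -> nat) :
  exists X : nat * nat -> point,
    generic tri (map X (red_idx w ++ blue_idx w)) /\
    (forall x, In x (red_idx w ++ blue_idx w) -> in_tri (X x)) /\
    forall p q E out i j, In (p, q, E, out) families ->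
      (p < 6)%nat -> (q < 6)%nat -> In (p, i) (cluster w p) -> In (q, j) (cluster w q) ->
      exists c rho,
        in_poly tri c /\ gdist tri c (X (p, i)) = rho /\ gdist tri c (X (q, j)) = rho /\
        (count_in_disk tri c rho (map X (red_idx w ++ blue_idx w)) <=
         list_sum (map (cluster_bound w p out) (seq 0 6)))%nat.
Proof.
  destruct (clusters_exist (w 0 + w 1 + w 2 + w 3 + w 4 + w 5)%nat
              (red_idx w ++ blue_idx w)) as [X [HG [HT HX]]].
  - apply NoDup_idx.
  - intros l k H; apply in_idx in H; rewrite !in_cluster in H.
    repeat (destruct H as [H|H]); destruct H as [k' [H Hk]];
      injection H as -> ->; lia.
  - exists X; split; [exact HG|split; [exact HT|]].
    intros p q E out i j Hs Hp Hq Hi Hj.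
    apply (cluster_incl_idx w p Hp) in Hi as Hi'.
    apply (cluster_incl_idx w q Hq) in Hj as Hj'.
    destruct (HX p q E out i j Hs Hi' Hj') as [Hd [Hc [Hout Hin]]].
    set (r := X (p, i)) in *; set (b := X (q, j)) in *.
    exists (center E r b), (edist (center E r b) r).
    assert (Hgd : forall x, In x (red_idx w ++ blue_idx w) ->
              gdist tri (center E r b) (X x) = edist (center E r b) (X x))
      by (intros x Hx; apply gdist_tri; auto).
    split; [apply in_poly_of_in_tri; exact Hc|].
    split; [apply Hgd; exact Hi'|].
    split; [unfold b; rewrite Hgd by exact Hj'; apply edist_center; fold b; lra|].
    assert (Hl : forall l, (l < 6)%nat ->
      (count_in_disk tri (center E r b) (edist (center E r b) r) (map X (cluster w l))
       <= cluster_bound w p out l)%nat).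
    { intros l Hl6; unfold cluster_bound.
      pose proof (cluster_incl_idx w l Hl6) as Hincl.
      destruct (Nat.eqb_spec l p) as [->|Hlp];
        [|destruct (existsb (Nat.eqb l) out) eqn:Hex].
      - apply count_in_disk_le1 with (p, i); [apply NoDup_cluster|].
        intros y Hy Hne; rewrite Hgd by auto; apply edist_center_lt; [exact Hd|].
        apply in_cluster in Hy as Hy'; destruct Hy' as [k [-> _]].
        apply Hin; [congruence|auto].
      - apply existsb_exists in Hex as [l' [Hl' E']]; apply Nat.eqb_eq in E' as <-.
        rewrite count_in_disk_0; [lia|].
        intros z Hz; apply in_map_iff in Hz as [y [<- Hy]].
        rewrite Hgd by auto; apply edist_center_lt; [exact Hd|].
        apply in_cluster in Hy as Hy'; destruct Hy' as [k [-> _]].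
        apply Hout; auto.
      - eapply Nat.le_trans; [apply count_in_disk_le|].
        unfold cluster; rewrite !length_map, length_seq; lia. }
    unfold red_idx, blue_idx; rewrite !map_app, !count_in_disk_app.
    pose proof (Hl 0%nat ltac:(lia)); pose proof (Hl 1%nat ltac:(lia));
      pose proof (Hl 2%nat ltac:(lia)); pose proof (Hl 3%nat ltac:(lia));
      pose proof (Hl 4%nat ltac:(lia)); pose proof (Hl 5%nat ltac:(lia)).
    change (list_sum (map (cluster_bound w p out) (seq 0 6))) with
      (cluster_bound w p out 0 + (cluster_bound w p out 1 + (cluster_bound w p out 2 +
       (cluster_bound w p out 3 + (cluster_bound w p out 4 +
       (cluster_bound w p out 5 + 0))))))%nat.
    lia.
Qed.

(** * Cluster sizes and the nine red-blue pairs *)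

Ltac in_families :=
  unfold families; simpl; solve [repeat first [left; reflexivity | right]].

Theorem theorem12 :
  forall n : nat, (6 <= n)%nat -> Nat.Even n ->
  exists (V red blue : list point),
    simple_polygon V /\
    length red = (n / 2)%nat /\ length blue = (n / 2)%nat /\
    NoDup (red ++ blue) /\
    (forall s, In s (red ++ blue) -> in_poly V s) /\
    general_position V (red ++ blue) /\
    (forall r b, In r red -> In b blue ->
       exists (c : point) (rho : R),
         in_poly V c /\ gdist V c r = rho /\ gdist V c b = rho /\
         (count_in_disk V c rho (red ++ blue) <= (n + 4) / 5 + 1)%nat).
Proof.
  intros n Hn [m Hm].
  replace (n / 2)%nat with m by (rewrite Hm, Nat.mul_comm, Nat.div_mul; lia).
  set (k := ((n + 4) / 5)%nat).
  assert (Hk : (5 * k <= n + 4 < 5 * k + 5)%nat).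
  { unfold k; pose proof (Nat.div_mod_eq (n + 4) 5);
      pose proof (Nat.mod_upper_bound (n + 4) 5); lia. }
  assert (Hsz : exists a a' s : nat,
    (a + a' + s = m /\ a <= k /\ a' <= k /\ s + s <= k)%nat).
  (* From [2 * m <= 5 * k] the rest [m - k / 2] is at most [2 * k + 1/2], hence at most [2 * k], and
     its two halves are at most [k]. *)
  { exists ((m - k / 2) / 2)%nat, (m - k / 2 - (m - k / 2) / 2)%nat, (k / 2)%nat.
    pose proof (Nat.div_mod_eq k 2); pose proof (Nat.mod_upper_bound k 2).
    pose proof (Nat.div_mod_eq (m - k / 2) 2);
      pose proof (Nat.mod_upper_bound (m - k / 2) 2); lia. }
  destruct Hsz as [a [a' [s [Hsum [Ha [Ha' Hs]]]]]].
  set (w := fun l => nth l [a; a'; s; a; a'; s] 0%nat).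
  destruct (clusters_with_disks w) as [X [HG [HT HX]]].
  exists tri, (map X (red_idx w)), (map X (blue_idx w)).
  rewrite <- map_app.
  assert (HS : forall x, In x (map X (red_idx w ++ blue_idx w)) -> in_tri x)
    by (intros x Hx; apply in_map_iff in Hx as [y [<- Hy]]; auto).
  split; [exact simple_polygon_tri|].
  split; [unfold red_idx, cluster; rewrite !map_app, !length_app, !length_map, !length_seq;
          unfold w; simpl; lia|].
  split; [unfold blue_idx, cluster; rewrite !map_app, !length_app, !length_map, !length_seq;
          unfold w; simpl; lia|].
  split; [apply HG|].
  split; [intros x Hx; apply in_poly_of_in_tri; auto|].
  split; [apply general_position_tri; assumption|].
  intros r b Hr Hb.
  apply in_map_iff in Hr as [x [<- Hr]]; apply in_map_iff in Hb as [y [<- Hb]].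
  set (good := fun x y : nat * nat => exists (c : point) (rho : R),
    in_poly tri c /\ gdist tri c (X x) = rho /\ gdist tri c (X y) = rho /\
    (count_in_disk tri c rho (map X (red_idx w ++ blue_idx w)) <= k + 1)%nat).
  (* The touched cluster, listed first in a family, may be red or blue. *)
  assert (Hsym : forall x y, good y x -> good x y)
    by (intros x' y' [c [rho H]]; exists c, rho; tauto).
  assert (Hgood : forall p q E out x y,
    In x (cluster w p) -> In y (cluster w q) -> In (p, q, E, out) families ->
    (p < 6)%nat -> (q < 6)%nat ->
    (list_sum (map (cluster_bound w p out) (seq 0 6)) <= k + 1)%nat -> good x y).
  { intros p q E out x' y' Hx Hy Hf Hp Hq Hle.
    apply in_cluster in Hx as Hx'; destruct Hx' as [i [-> _]].
    apply in_cluster in Hy as Hy'; destruct Hy' as [j [-> _]].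
    destruct (HX p q E out i j Hf Hp Hq Hx Hy) as [c [rho [H1 [H2 [H3 H4]]]]].
    exists c, rho; repeat split; try assumption; lia. }
  change (good x y).
  unfold red_idx in Hr; unfold blue_idx in Hb; rewrite !in_app_iff in Hr, Hb.
  (* The bounds sum to 1 plus the size of cluster [q], except for clusters 4 and 2, where they sum
     to [1 + s + s]. *)
  destruct Hr as [Hr|[Hr|Hr]]; destruct Hb as [Hb|[Hb|Hb]];
    first [ eapply Hgood; [exact Hr|exact Hb|in_families| | |]
          | apply Hsym; eapply Hgood; [exact Hb|exact Hr|in_families| | |] ];
    try lia; unfold cluster_bound, w; simpl; lia.
Qed.
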